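(* Let $k\ge1$. The probability generating function $G_{V(k)}(s)=\sum_{v\ge 0}P(V(k)=v)s^v$ of $V(k)$ is given (as a formal power series in $s$) by $$G_{V(k)}(s)=\frac{\alpha^{k-1}s^k\{p+(q-\beta)s\}}{1-\beta s-\sum_{i=2}^{k}\alpha^{i-2}(1-\alpha)(1-\beta)s^i} =\frac{\alpha^{k-1}s^k\{p+(q-\beta)s\}(1-\alpha s)}{1-(\alpha+\beta)s-(1-\alpha-\beta)s^{2}+\alpha^{k-1}(1-\alpha)(1-\beta)s^{k+1}}.$$
   Context: $(X_i)_{i\ge1}$ is an infinite sequence of two-state ($0$/$1$) Markov dependent Bernoulli trials (a time-homogeneous Markov chain) with $P(X_i=1)=p$, $P(X_i=0)=1-p=q$, and, for $i>1$, $P(X_i=1\mid X_{i-1}=1)=\alpha$ and $P(X_i=0\mid X_{i-1}=0)=\beta$. For a positive integer $k$, $V(k)=\min\{n\ge k: X_{n-k+1}=\cdots=X_n=1\}$ is the waiting time until $k$ consecutive ones first occur. Conventions: $\alpha^0=1$; an empty sum is $0$. *)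

(* Defs.v *)
From HB Require Import structures.
From mathcomp Require Import all_boot all_order all_algebra.
From mathcomp Require Import all_classical all_reals all_analysis.

Set Implicit Arguments.
Unset Strict Implicit.
Unset Printing Implicit Defensive.

Import Order.TTheory GRing.Theory Num.Theory.

Local Open Scope classical_set_scope.
Local Open Scope ring_scope.

(** A formal power series over [R] is its sequence of coefficients. *)
Section FormalPowerSeries.
Variable R : fieldType.

Definition fps := nat -> R.

Definition fps_of_poly (f : {poly R}) : fps := fun n => f`_n.

Definition fps_mul (a b : fps) : fps :=
  fun n => \sum_(i < n.+1) a i * b (n - i)%N.

(* First [n] coefficients of [a / b], by long division. *)
Fixpoint fps_div_coefs (a b : fps) (n : nat) : seq R :=
  if n is m.+1 then
    let c := fps_div_coefs a b m in
    rcons c ((a m - \sum_(i < m) c`_i * b (m - i)%N) / b 0%N)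
  else [::].

(* Meaningful when [b 0 != 0]: see [fps_divK] and [fps_div_unique]. *)
Definition fps_div (a b : fps) : fps := fun n => (fps_div_coefs a b n.+1)`_n.

Lemma size_fps_div_coefs a b n : size (fps_div_coefs a b n) = n.
Proof. by elim: n => //= n IH; rewrite size_rcons IH. Qed.

Lemma nth_fps_div_coefs a b n i : (i < n)%N ->
  (fps_div_coefs a b n)`_i = fps_div a b i.
Proof.
elim: n => // n IH; rewrite ltnS leq_eqVlt => /orP[/eqP-> //|lt_in].
by rewrite /= nth_rcons size_fps_div_coefs lt_in IH.
Qed.

Lemma fps_divE a b n :
  fps_div a b n = (a n - \sum_(i < n) fps_div a b i * b (n - i)%N) / b 0%N.
Proof.
rewrite {1}/fps_div /= nth_rcons size_fps_div_coefs ltnn eqxx.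
by under eq_bigr => i _ do rewrite nth_fps_div_coefs //.
Qed.

Lemma fps_divK a b : b 0%N != 0 -> fps_mul (fps_div a b) b = a.
Proof.
move=> b0; apply/funext => n.
by rewrite /fps_mul big_ord_recr /= subnn fps_divE divfK // addrC subrK.
Qed.

Lemma fps_div_unique a b c : b 0%N != 0 -> fps_mul c b = a -> c = fps_div a b.
Proof.
move=> b0 <-; apply/funext => n; elim/ltn_ind: n => n IH.
rewrite fps_divE /fps_mul big_ord_recr /= subnn addrC.
under [X in _ - X]eq_bigr => i _ do rewrite -IH //.
by rewrite addrK mulfK.
Qed.

End FormalPowerSeries.

Section MarkovBernoulli.
Context {d : measure_display} {Omega : measurableType d} {R : realType}.
Variable P : probability Omega R.

Definition prob (A : set Omega) : R := fine (P A).

Definition cond_prob (A B : set Omega) : R := prob (A `&` B) / prob B.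

(* Trials are indexed from 1; the term [X 0] is never looked at. *)
Variable X : nat -> {RV P >-> bool}.

Definition state (i : nat) (b : bool) : set Omega := [set w | X i w = b].

Definition history (n : nat) (x : nat -> bool) : set Omega :=
  [set w | forall i, (1 <= i <= n)%N -> X i w = x i].

Definition markov_property : Prop :=
  forall (n : nat) (x : nat -> bool) (b : bool), (1 <= n)%N ->
    0 < prob (history n x) ->
    cond_prob (state n.+1 b) (history n x) =
    cond_prob (state n.+1 b) (state n (x n)).

(* [p] is the law of the first trial; no stationarity is assumed. The
   transition probabilities are constrained only where the conditioning
   event has positive probability. *)
Record markov_bernoulli (p alpha beta : R) : Prop := MarkovBernoulli {
  mb_init1 : prob (state 1 true) = p;
  mb_init0 : prob (state 1 false) = 1 - p;
  mb_markov : markov_property;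
  mb_trans1 : forall i, (1 < i)%N -> 0 < prob (state i.-1 true) ->
    cond_prob (state i true) (state i.-1 true) = alpha;
  mb_trans0 : forall i, (1 < i)%N -> 0 < prob (state i.-1 false) ->
    cond_prob (state i false) (state i.-1 false) = beta }.

(* n >= k and X_(n-k+1) = ... = X_n = 1 *)
Definition run_at (k : nat) (w : Omega) (n : nat) : bool :=
  (k <= n)%N && all (fun j => X j w) (iota (n - k).+1 k).

(* [None] when no run of length [k] ever occurs. *)
Definition waiting_time (k : nat) (w : Omega) : option nat :=
  if pselect (exists n, run_at k w n) is left ex_run then Some (ex_minn ex_run)
  else None.

Definition waiting_time_pgf (k : nat) : fps R :=
  fun v => prob [set w | waiting_time k w = Some v].

Lemma waiting_timeP k w v :
  waiting_time k w = Some v <->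
  run_at k w v /\ forall m, (m < v)%N -> ~~ run_at k w m.
Proof.
rewrite /waiting_time; case: pselect => [ex_run|no_run]; last first.
  by split=> // -[run_v _]; case: no_run; exists v.
case: ex_minnP => n run_n min_n; split=> [[<-]|[run_v min_v]].
  by split=> // m; apply: contraTN => /min_n; rewrite -leqNgt.
congr Some; apply/eqP; rewrite eqn_leq min_n //= leqNgt.
by apply: contraL run_n => /min_v.
Qed.

Lemma measurable_run_at k n : measurable [set w | run_at k w n].
Proof.
rewrite (_ : [set _ | _] =
  if (k <= n)%N then \big[setI/setT]_(j <- iota (n - k).+1 k) state j true
  else set0).
  case: ifP => // _; apply: bigsetI_measurable => j _.
  exact: (measurable_funPTI (X j) (Y := [set true])).
rewrite /run_at; case: (k <= n)%N; last by apply/seteqP; split.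
elim: (iota _ _) => [|j s IH]; first by rewrite big_nil; apply/seteqP; split.
rewrite big_cons -IH; apply/seteqP; split => w /=.
  by move=> /andP[].
by move=> [Xj Xs]; apply/andP; split.
Qed.

Lemma measurable_waiting_time k v :
  measurable [set w | waiting_time k w = Some v].
Proof.
rewrite (_ : [set _ | _] = [set w | run_at k w v] `&`
  \big[setI/setT]_(m < v) ~` [set w | run_at k w m]).
  apply: measurableI; first exact: measurable_run_at.
  apply: bigsetI_measurable => m _; apply: measurableC.
  exact: measurable_run_at.
rewrite -(bigcap_mkord v (fun m => ~` [set w | run_at k w m])); apply/seteqP; split => w /=.
  by move=> /waiting_timeP[run_v min_v]; split=> // m /= /min_v /negP.
by move=> [run_v min_v]; apply/waiting_timeP; split=> // m ?; apply/negP/min_v.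
Qed.

End MarkovBernoulli.

(* Main.v *)
Require Import Defs.
From HB Require Import structures.
From mathcomp Require Import all_boot all_order all_algebra.
From mathcomp Require Import all_classical all_reals all_analysis.
From mathcomp Require Import ring zify.

Set Implicit Arguments.
Unset Strict Implicit.
Unset Printing Implicit Defensive.

Import Order.TTheory GRing.Theory Num.Theory.

Local Open Scope ring_scope.

(** Condition on the last zero before the first run of [k] ones. Let [z n] be the
    probability that trial [n] is a zero and no run has occurred so far. From a
    zero at [n], the run is completed at time [n + k] with probability
    [(1 - beta) * alpha ^+ (k - 1)], while the next zero comes after exactly
    [j < k] ones with probability [beta] if [j = 0] and
    [(1 - beta) * alpha ^+ (j - 1) * (1 - alpha)] otherwise. Hence [z] satisfies a
    renewal equation whose kernel is one minus the first denominator, and the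
    generating function of the waiting time is
    [alpha ^+ (k - 1) * s ^ k * (p + (1 - beta) * z(s))]. The second fraction is the
    first one expanded by [1 - alpha * s], which telescopes the geometric sum. *)

(** * Algebra of formal power series and the geometric sum *)

Section FormalPowerSeriesProducts.
Variable R : fieldType.
Implicit Types (a b c : fps R) (f g : {poly R}).

(** Coefficient [n] of a product involves only coefficients up to [n], so truncating both factors to
    polynomials loses nothing. This transfers ring laws from [{poly R}] to power series. *)
Lemma fps_mul_trunc a b N n : (n < N)%N ->
  fps_mul a b n = (\poly_(i < N) a i * \poly_(i < N) b i)`_n.
Proof.
move=> nN; rewrite coefM; apply: eq_bigr => i _.
by rewrite !coef_poly !ifT //; have := ltn_ord i; lia.
Qed.

Lemma fps_mulA a b c : fps_mul a (fps_mul b c) = fps_mul (fps_mul a b) c.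
Proof.
have truncM (u v : fps R) n : (\poly_(i < n.+1) fps_mul u v i)`_n =
    (\poly_(i < n.+1) u i * \poly_(i < n.+1) v i)`_n.
  by rewrite coef_poly ltnSn; apply: fps_mul_trunc.
apply/funext => n; rewrite !(fps_mul_trunc _ _ (ltnSn n)).
transitivity ((\poly_(i < n.+1) a i * \poly_(i < n.+1) b i
  * \poly_(i < n.+1) c i)`_n).
  rewrite -mulrA 2!coefM; apply: eq_bigr => i _; congr (_ * _).
  by rewrite coef_poly (fps_mul_trunc _ _ (N := n.+1)) ?ifT //; lia.
rewrite 2!coefM; apply: eq_bigr => i _; congr (_ * _).
by rewrite coef_poly ltn_ord (fps_mul_trunc _ _ (N := n.+1)).
Qed.

Lemma fps_mulC a b : fps_mul a b = fps_mul b a.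
Proof.
by apply/funext => n; rewrite !(fps_mul_trunc _ _ (ltnSn n)) mulrC.
Qed.

Lemma fps_of_polyM f g :
  fps_of_poly (f * g) = fps_mul (fps_of_poly f) (fps_of_poly g).
Proof. by apply/funext => n; rewrite /fps_of_poly coefM. Qed.

Lemma fps_mulDl a b c n :
  fps_mul (fun i => a i + b i) c n = fps_mul a c n + fps_mul b c n.
Proof.
by rewrite /fps_mul -big_split; apply: eq_bigr => i _; rewrite mulrDl.
Qed.

Lemma fps_mul_scaleXn x m a n :
  fps_mul (fps_of_poly (x *: 'X^m)) a n = if (m <= n)%N then x * a (n - m)%N else 0.
Proof.
rewrite /fps_mul /fps_of_poly; case: leqP => [mn|nm].
  have lt_mn : (m < n.+1)%N by [].
  rewrite (bigD1 (Ordinal lt_mn)) //= coefZ coefXn eqxx mulr1 big1 ?addr0 //.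
  move=> i /eqP neq; rewrite coefZ coefXn; case: eqP => [eq|];
    last by rewrite mulr0 mul0r.
  by case: neq; apply: val_inj.
rewrite big1 // => i _; rewrite coefZ coefXn; case: eqP => [eq|];
    last by rewrite mulr0 mul0r.
by have := ltn_ord i; lia.
Qed.

Lemma coef_sum_scaleXn (e : nat -> R) l m n :
  (\sum_(l <= i < m) e i *: 'X^i)`_n = if (l <= n < m)%N then e n else 0.
Proof.
rewrite coef_sum (eq_bigr (fun i => if i == n then e i else 0)); last first.
  by move=> i _; rewrite coefZ coefXn eq_sym; case: eqP; rewrite ?mulr1 ?mulr0.
rewrite -big_mkcond /= big_nat1_eq //.
Qed.

(** The product telescopes. For [k = 1] the sum is empty and the right side is ['X^2 - 'X^2]. *)
Lemma mulr_sum_geometricX (x : R) k : (0 < k)%N ->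
  (\sum_(2 <= i < k.+1) x ^+ (i - 2) *: 'X^i) * (1 - x *: 'X) =
  'X^2 - x ^+ (k - 1) *: 'X^(k.+1).
Proof.
elim: k => // -[_ _|k /(_ isT) IH _].
  by rewrite big_geq // mul0r expr0 scale1r subrr.
rewrite big_nat_recr //= mulrDl IH.
have -> : (k.+1 - 1 = k)%N by lia.
have -> : (k.+2 - 2 = k)%N by lia.
have -> : (k.+2 - 1 = k.+1)%N by lia.
by rewrite -!mul_polyC !exprS !rmorphM; ring.
Qed.

End FormalPowerSeriesProducts.

(** * Events depending on finitely many trials *)

Section RunsOfOnes.
Local Open Scope classical_set_scope.
Context {d : measure_display} {Omega : measurableType d} {R : realType}.
Variable P : probability Omega R.
Implicit Types A B : set Omega.

Lemma prob0 : prob P set0 = 0.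
Proof. by rewrite /prob measure0. Qed.

Lemma prob_ge0 A : 0 <= prob P A.
Proof. by rewrite /prob fine_ge0. Qed.

Lemma probU A B : measurable A -> measurable B -> A `&` B = set0 ->
  prob P (A `|` B) = prob P A + prob P B.
Proof.
by move=> mA mB AB; rewrite /prob measureU // fineD // fin_num_measure.
Qed.

Lemma le_prob A B : measurable A -> measurable B -> A `<=` B ->
  prob P A <= prob P B.
Proof.
move=> mA mB AB; rewrite /prob fine_le ?fin_num_measure //.
by apply: le_measure => //; rewrite inE.
Qed.

Variable X : nat -> {RV P >-> bool}.

Lemma measurable_state n b : measurable (state X n b).
Proof. exact: (measurable_funPTI (X n) (Y := [set b])). Qed.

Lemma probIstate A n : measurable A ->
  prob P A = prob P (A `&` state X n true) + prob P (A `&` state X n false).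
Proof.
move=> mA; rewrite -probU; first 1 last.
- exact: measurableI (measurable_state n true).
- exact: measurableI (measurable_state n false).
- by apply/seteqP; split=> // w [[_ +] [_ +]]; rewrite /state /= => ->.
congr prob; apply/seteqP; split=> w; last by case=> -[].
by move=> Aw; case E : (X n w); [left|right].
Qed.

(** This replaces membership in the sigma-algebra generated by trials 1 to [n]; measurability is
    then a consequence. *)
Definition determined n A :=
  forall w w', (forall i, (1 <= i <= n)%N -> X i w = X i w') -> A w -> A w'.

Lemma determinedI n A B :
  determined n A -> determined n B -> determined n (A `&` B).
Proof. by move=> dA dB w w' ww' [Aw Bw]; split; [exact: dA Aw|exact: dB Bw]. Qed.

Lemma determined_le m n A : (m <= n)%N -> determined m A -> determined n A.
Proof.
by move=> mn dA w w' ww'; apply: dA => i im; apply: ww'; lia.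
Qed.

Lemma determined_state n b : (0 < n)%N -> determined n (state X n b).
Proof. by move=> n0 w w' ww' <-; rewrite /state /= ww' // n0 leqnn. Qed.

Lemma historyS n x :
  history X n.+1 x = history X n x `&` state X n.+1 (x n.+1).
Proof.
apply/seteqP; split=> w /=.
  move=> xw; split; last by apply: xw; rewrite leqnn.
  by move=> i ?; apply: xw; lia.
move=> [xw xn] i /andP[i0]; rewrite leq_eqVlt => /orP[/eqP->//|?].
by apply: xw; rewrite i0.
Qed.

Lemma measurable_history n x : measurable (history X n x).
Proof.
elim: n => [|n IH].
  by rewrite (_ : history X 0 x = setT) //; apply/seteqP; split=> // w _ [].
by rewrite historyS; apply: measurableI => //; apply: measurable_state.
Qed.

(** A determined event is a finite disjoint union of histories. The induction releases the fixed
    trials one at a time, from [n] downwards, splitting on the value of the released trial. *)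
Lemma determined_ind (C : set Omega -> Prop) n A :
  C set0 -> (forall x, C (history X n x)) ->
  (forall B B', B `&` B' = set0 -> C B -> C B' -> C (B `|` B')) ->
  determined n A -> C A.
Proof.
move=> C0 Chist CU dA.
have CA m x : (m <= n)%N -> C (A `&` history X (n - m) x).
  elim: m x => [x _|m IH x lt_mn].
    (* A history of full length fixes everything [A] depends on, so it lies inside [A] or misses
       it. *)
    rewrite subn0; have [[w [Aw xw]]|none] :=
      pselect (exists w, A w /\ history X n x w).
      rewrite setIidr // => w' xw'; apply: dA Aw => i ni.
      by rewrite xw // xw'.
    rewrite (_ : _ `&` _ = set0) //; apply/seteqP; split=> // w [Aw xw].
    by apply: none; exists w.
  pose up b i := if i == (n - m)%N then b else x i.
  have -> : A `&` history X (n - m.+1) x =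
     (A `&` history X (n - m) (up true)) `|` (A `&` history X (n - m) (up false)).
    have E b : history X (n - m) (up b) =
        history X (n - m.+1) x `&` state X (n - m) b.
      rewrite (_ : (n - m = (n - m.+1).+1)%N); last by lia.
      rewrite historyS /up (_ : ((n - m.+1).+1 = n - m)%N); last by lia.
      rewrite eqxx; congr (_ `&` _); apply/seteqP; split=> w xw i ii;
        by have := xw i ii; rewrite ifN //; lia.
    rewrite !E; apply/seteqP; split=> w; last by case=> -[? []].
    by case=> Aw xw; case Ew : (X (n - m)%N w); [left|right].
  apply: CU; [|by apply: IH; lia..].
  apply/seteqP; split=> // w [[_ /(_ (n - m)%N)+] [_ /(_ (n - m)%N)]].
  by rewrite /up eqxx => ->; [move=> /(_ _)|]; lia.
by have := CA n (fun=> true) (leqnn _); rewrite subnn setIidl // => w _ [].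
Qed.

Lemma measurable_determined n A : determined n A -> measurable A.
Proof.
apply: determined_ind; first exact: measurable0.
- exact: measurable_history.
- by move=> B B' _; apply: measurableU.
Qed.

(** * Transition probabilities on determined events *)

Section Chain.
Variables (p alpha beta : R) (hX : markov_bernoulli X p alpha beta).

Definition trans (b b' : bool) : R :=
  if b then (if b' then alpha else 1 - alpha)
  else (if b' then 1 - beta else beta).

(** The hypotheses give one entry in each row of the transition matrix; the other follows because a
    row sums to 1. *)
Lemma cond_prob_state n b b' : (1 <= n)%N -> 0 < prob P (state X n b) ->
  cond_prob P (state X n.+1 b') (state X n b) = trans b b'.
Proof.
move=> n1 Pb.
have : cond_prob P (state X n.+1 true) (state X n b) +
    cond_prob P (state X n.+1 false) (state X n b) = 1.
  rewrite /cond_prob -mulrDl ![state X n.+1 _ `&` _]setIC -probIstate.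
    by rewrite divff // gt_eqF.
  exact: measurable_state.
case: b Pb => Pb.
  have -> := mb_trans1 hX (i := n.+1) n1 Pb.
  by case: b' => /= [_|<-]; rewrite ?(mb_trans1 hX (i := n.+1)) // addrAC subrr add0r.
have -> := mb_trans0 hX (i := n.+1) n1 Pb.
by case: b' => /= [<-|_]; rewrite ?(mb_trans0 hX (i := n.+1)) // addrK.
Qed.

(** Extends the Markov property from single histories to determined events, by additivity over
    disjoint unions. *)
Lemma prob_transition n A b b' : (1 <= n)%N -> determined n A ->
  A `<=` state X n b ->
  prob P (A `&` state X n.+1 b') = trans b b' * prob P A.
Proof.
move=> n1 dA; have := dA.
(* Additivity needs measurable pieces, and the inclusion is kept as a premise so that each piece
   inherits it from the union. *)
pose C B := measurable B /\ (B `<=` state X n b ->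
  prob P (B `&` state X n.+1 b') = trans b b' * prob P B).
suff : C A by case.
apply: (@determined_ind C n) dA => [|x|B B' BB' [mB CB] [mB' CB']].
- by split=> // _; rewrite set0I prob0 mulr0.
- split=> [|sub]; first exact: measurable_history.
  have mH := measurable_history n x.
  (* The Markov property says nothing about null histories; there both sides are 0. *)
  have [H0|H0] := leP (prob P (history X n x)) 0.
    have PH : prob P (history X n x) = 0 by apply/le_anti; rewrite H0 prob_ge0.
    rewrite PH mulr0; apply/le_anti; rewrite prob_ge0 andbT -PH.
    apply: le_prob => //.
    exact: measurableI (measurable_state _ _).
  have [w xw] : history X n x !=set0.
    by apply/set0P/eqP => H; move: H0; rewrite H prob0 ltxx.
  have xnb : x n = b by rewrite -(sub w xw) xw // n1 leqnn.
  have Pn : 0 < prob P (state X n b).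
    by apply: lt_le_trans H0 _; apply: le_prob => //; apply: measurable_state.
  have := mb_markov hX b' n1 H0; rewrite xnb cond_prob_state // => <-.
  by rewrite /cond_prob divfK ?gt_eqF // setIC.
- split=> [|sub]; first exact: measurableU.
  have mS := measurable_state n.+1 b'.
  rewrite setIUl !probU ?mulrDr //; try exact: measurableI.
    by rewrite CB ?CB' // => w ?; apply: sub; [right|left].
  by rewrite setIACA BB' set0I.
Qed.


Definition ones m j : set Omega := [set w | forall i, (m < i <= m + j)%N -> X i w].

Lemma ones0 m : ones m 0 = setT.
Proof. by apply/seteqP; split=> // w _ i ?; lia. Qed.

Lemma onesS m j : ones m j.+1 = state X m.+1 true `&` ones m.+1 j.
Proof.
apply/seteqP; split=> w.
  move=> mw; split; first by apply: mw; lia.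
  by move=> i ?; apply: mw; lia.
move=> [mw mw'] i /andP[]; rewrite leq_eqVlt => /orP[/eqP<- //|? ?].
by apply: mw'; lia.
Qed.

Lemma determined_ones m j : determined (m + j) (ones m j).
Proof. by move=> w w' ww' mw i im; rewrite -ww' ?mw //; lia. Qed.

(** The induction absorbs the first of the new ones into [A], hence [n] and [A] vary. *)
Lemma prob_ones n A j : (1 <= n)%N -> determined n A -> A `<=` state X n true ->
  prob P (A `&` ones n j) = alpha ^+ j * prob P A.
Proof.
elim: j n A => [|j IH] n A n1 dA sA; first by rewrite ones0 setIT mul1r.
rewrite onesS setIA IH //.
  by rewrite (prob_transition true n1 dA sA) mulrA exprSr.
by apply: determinedI; [apply: determined_le dA|apply: determined_state].
Qed.

Lemma prob_ones_init j : prob P (ones 0 j.+1) = alpha ^+ j * p.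
Proof.
rewrite onesS prob_ones //; first by rewrite (mb_init1 hX).
exact: determined_state.
Qed.

Lemma prob_ones_after_zero n A j : (1 <= n)%N -> determined n A ->
  A `<=` state X n false ->
  prob P (A `&` ones n j.+1) = alpha ^+ j * (1 - beta) * prob P A.
Proof.
move=> n1 dA sA; rewrite onesS setIA prob_ones //.
  by rewrite (prob_transition true n1 dA sA) mulrA.
by apply: determinedI; [apply: determined_le dA|apply: determined_state].
Qed.

(** * The first run and the zeros that precede it *)

Variable k : nat.
Hypothesis k_gt0 : (0 < k)%N.

Lemma run_atP w n :
  reflect ((k <= n)%N /\ forall i, (n - k < i <= n)%N -> X i w) (run_at X k w n).
Proof.
apply: (iffP andP) => -[kn]; [move=> /allP Xw|move=> Xw]; split=> //.
  by move=> i ?; apply: Xw; rewrite mem_iota; lia.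
by apply/allP => i; rewrite mem_iota => ?; apply: Xw; lia.
Qed.

Lemma not_run_at w i n : X i w = false -> (n - k < i <= n)%N -> ~~ run_at X k w n.
Proof. by move=> Xi ni; apply/run_atP => -[_ /(_ i ni)]; rewrite Xi. Qed.

Definition no_run n : set Omega :=
  [set w | forall m, (m <= n)%N -> ~~ run_at X k w m].

Lemma determined_no_run n : determined n (no_run n).
Proof.
move=> w w' ww' nw m mn; apply: contra (nw m mn) => /run_atP[km Xw].
by apply/run_atP; split=> // i ?; rewrite ww' ?Xw //; lia.
Qed.

Lemma no_run_lt n w : (n < k)%N -> no_run n w.
Proof. by move=> nk m mn; apply/run_atP => -[? _]; lia. Qed.

(* The zero at [n - j] meets every window of length [k] ending in [(n - j, n]]. *)
Lemma no_run_zero n j w : (j < k)%N -> (j < n)%N -> X (n - j)%N w = false ->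
  no_run n w <-> no_run (n - j) w.
Proof.
move=> jk jn Xw; split=> nw m mn; first by apply: nw; lia.
have [?|?] := leqP m (n - j)%N; first exact: nw.
have [km|mk] := leqP k m; last by apply/run_atP => -[? _]; lia.
by apply: not_run_at Xw _; lia.
Qed.

(** Index 0 is set to 0 because [X 0] is not a trial. *)
Definition zero_no_run : fps R :=
  fun n => if n is 0%N then 0 else prob P (no_run n `&` state X n false).

Lemma waiting_time_pgf_lt n : (n < k)%N -> waiting_time_pgf X k n = 0.
Proof.
move=> nk; rewrite /waiting_time_pgf (_ : [set _ | _] = set0) ?prob0 //.
apply/seteqP; split=> // w /= /waiting_timeP[/run_atP[? _] _]; lia.
Qed.

Lemma waiting_time_pgf_eq : waiting_time_pgf X k k = alpha ^+ (k - 1) * p.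
Proof.
rewrite -prob_ones_init /waiting_time_pgf; congr prob.
apply/seteqP; split=> w /=.
  by move=> /waiting_timeP[/run_atP[_ Xw] _] i ?; apply: Xw; lia.
move=> Xw; apply/waiting_timeP; split; last first.
  by move=> m mk; apply/run_atP => -[? _]; lia.
by apply/run_atP; split=> // i ?; apply: Xw; lia.
Qed.

(** A first run that does not start at trial 1 must directly follow a zero, here at trial [n]. *)
Lemma waiting_time_pgf_gt n : (1 <= n)%N ->
  waiting_time_pgf X k (n + k)%N =
  alpha ^+ (k - 1) * (1 - beta) * zero_no_run n.
Proof.
case: n => // n _; rewrite /= -(@prob_ones_after_zero n.+1) //; last first.
  by apply: determinedI; [exact: determined_no_run|exact: determined_state].
rewrite /waiting_time_pgf; congr prob; apply/seteqP; split=> w /=.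
  move=> /waiting_timeP[/run_atP[_ Xw] nw]; split; last first.
    by move=> i ?; apply: Xw; lia.
  split; first by move=> m ?; apply: nw; lia.
  (* Were trial [n.+1] a one, the window ending one step earlier would already be a run. *)
  apply/negP => Xn; have /run_atP[] : ~~ run_at X k w (n + k) by apply: nw; lia.
  split; first by lia.
  move=> i ni; have [->//|ne] := eqVneq i n.+1.
  by apply: Xw; lia.
move=> [[nw Xn] Xw]; apply/waiting_timeP; split.
  by apply/run_atP; split=> [|i ?]; [|apply: Xw]; lia.
move=> m mn; have [?|?] := leqP m n.+1; first exact: nw.
have [km|mk] := leqP k m; last by apply/run_atP => -[? _]; lia.
by apply: not_run_at Xn _; lia.
Qed.

(* Probability of returning to 0 after exactly [j] ones. *)
Definition return_weight j : R :=
  if j is j'.+1 then alpha ^+ j' * (1 - beta) * (1 - alpha) else beta.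

(** Interpolates between [zero_no_run n.+1] at [j = 0] and the absence of any earlier zero at
    [j = n]. *)
Definition no_run_tail n j : R :=
  prob P (no_run n `&` ones (n - j) j `&` state X n.+1 false).

Lemma prob_return n A j : (1 <= n)%N -> determined n A -> A `<=` state X n false ->
  prob P (A `&` ones n j `&` state X (n + j).+1 false) =
  return_weight j * prob P A.
Proof.
case: j => [|j] n1 dA sA.
  by rewrite ones0 setIT addn0 (prob_transition false n1 dA sA).
rewrite (@prob_transition _ _ true); first 1 last.
- by lia.
- by apply: determinedI; [apply: determined_le dA; lia|exact: determined_ones].
- by move=> w [_]; apply; lia.
by rewrite prob_ones_after_zero //= mulrA [_ * (1 - alpha)]mulrC.
Qed.

Lemma no_run_tail0 n : zero_no_run n.+1 = no_run_tail n 0.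
Proof.
rewrite /no_run_tail ones0 setIT; congr prob; apply/seteqP; split=> w [nw Xw].
  by split=> // m ?; apply: nw; lia.
split=> // m; rewrite leq_eqVlt => /orP[/eqP->|]; last exact: nw.
by apply: not_run_at Xw _; lia.
Qed.

(** Split on trial [n - j]: a zero there is a renewal, since no run can then be completed within the
    next [j < k] trials; a one lengthens the tail. *)
Lemma no_run_tail_step n j : (j < k)%N -> (j < n)%N ->
  no_run_tail n j = return_weight j * zero_no_run (n - j)%N + no_run_tail n j.+1.
Proof.
move=> jk jn; set A := no_run (n - j) `&` state X (n - j) false.
have dA : determined (n - j) A.
  by apply: determinedI; [exact: determined_no_run|apply: determined_state; lia].
have -> : zero_no_run (n - j)%N = prob P A.
  by rewrite /A; case: (n - j)%N (subn_gt0 j n) => //; rewrite jn.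
rewrite -(@prob_return (n - j)) //; [|by lia|by move=> w []].
rewrite subnK 1?ltnW // /no_run_tail (@probIstate _ (n - j)); last first.
  apply: (@measurable_determined n.+1); apply: determinedI; last exact: determined_state.
  apply: determinedI; first exact: determined_le (leqnSn n) (@determined_no_run n).
  by have := @determined_ones (n - j) j; apply: determined_le; lia.
rewrite addrC; congr (prob P _ + prob P _).
  apply/seteqP; split=> w.
    by move=> [[[nw ow] Xn] Xj]; do 3?split=> //; apply/(no_run_zero jk jn Xj).
  by move=> [[[nw Xj] ow] Xn]; do 3?split=> //; apply/(no_run_zero jk jn Xj).
have -> : ones (n - j.+1) j.+1 = state X (n - j) true `&` ones (n - j) j.
  by rewrite onesS (_ : (n - j.+1).+1 = (n - j)%N) //; lia.
by apply/seteqP; split=> w [[]]; [move=> [nw ow] sn sj|move=> nw [sj ow] sn].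
Qed.

Lemma no_run_tail_ge n j : (k <= j <= n)%N -> no_run_tail n j = 0.
Proof.
move=> kjn; rewrite /no_run_tail (_ : _ `&` _ = set0) ?prob0 //.
apply/seteqP; split=> // w [[nw ow] _].
have /run_atP[] := nw n (leqnn n).
by split=> [|i ?]; [|apply: ow]; lia.
Qed.

(* Coefficient of [s ^ n.+1]: probability that the first zero occurs at trial
   [n.+1] before any run. *)
Definition first_zero n : R :=
  if n is n'.+1 then alpha ^+ n' * p * (1 - alpha) else 1 - p.

Lemma no_run_tail_init n : (n < k)%N -> no_run_tail n n = first_zero n.
Proof.
move=> nk; rewrite /no_run_tail subnn (_ : no_run n = setT); last first.
  by apply/seteqP; split=> // w _; apply: no_run_lt.
rewrite setTI; case: n nk => [_|n nk]; first by rewrite ones0 setTI (mb_init0 hX).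
rewrite (@prob_transition _ _ true) //.
- by rewrite prob_ones_init /= mulrC.
- exact: (@determined_ones 0 n.+1).
- by move=> w; apply; lia.
Qed.

(** The renewal equation, summing [no_run_tail_step] over the position of the previous zero; the
    last term covers the case of no previous zero. *)
Lemma zero_no_run_recursion n :
  zero_no_run n.+1 =
  \sum_(j < n) (if (j < k)%N then return_weight j * zero_no_run (n - j)%N else 0) +
  (if (n < k)%N then first_zero n else 0).
Proof.
have -> : (if (n < k)%N then first_zero n else 0) = no_run_tail n n.
  case: ltnP => nk; first by rewrite no_run_tail_init.
  by rewrite no_run_tail_ge // nk leqnn.
rewrite no_run_tail0.
suff H m : (m <= n)%N -> no_run_tail n 0 =
    \sum_(j < m) (if (j < k)%N then return_weight j * zero_no_run (n - j)%N else 0)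
    + no_run_tail n m by exact: H.
elim: m => [|m IH] mn; first by rewrite big_ord0 add0r.
rewrite big_ord_recr /= IH; last exact: ltnW.
case: ltnP => mk; first by rewrite no_run_tail_step // addrA.
by rewrite !no_run_tail_ge ?addr0 //; lia.
Qed.

(** * Passage to generating functions *)

Definition run_denominator : {poly R} := 1 - beta *: 'X
  - \sum_(2 <= i < k.+1) (alpha ^+ (i - 2) * (1 - alpha) * (1 - beta)) *: 'X^i.

Definition first_zero_poly : {poly R} := (1 - p) *: 'X
  + \sum_(2 <= i < k.+1) (alpha ^+ (i - 2) * p * (1 - alpha)) *: 'X^i.

Lemma coef_run_denominator0 : run_denominator`_0 = 1.
Proof.
by rewrite /run_denominator !coefB coef1 coefZ coefX coef_sum_scaleXn mulr0 !subr0.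
Qed.

(** The shift by one appears because a return to zero after [n] ones takes [n.+1] trials. *)
Lemma coef_run_denominatorS n :
  run_denominator`_n.+1 = - (if (n < k)%N then return_weight n else 0).
Proof.
rewrite /run_denominator !coefB coef1 coefZ coefX coef_sum_scaleXn sub0r.
case: n => [|n] /=; first by rewrite k_gt0 mulr1 subr0.
by rewrite mulr0 oppr0 sub0r subn2 /= ltnS mulrAC.
Qed.

Lemma run_denominator_mulX : run_denominator * (1 - alpha *: 'X) =
  1 - (alpha + beta) *: 'X - (1 - alpha - beta) *: 'X^2
  + (alpha ^+ (k - 1) * (1 - alpha) * (1 - beta)) *: 'X^(k.+1).
Proof.
have sumE : \sum_(2 <= i < k.+1)
      (alpha ^+ (i - 2) * (1 - alpha) * (1 - beta)) *: 'X^i =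
    ((1 - alpha) * (1 - beta)) *: \sum_(2 <= i < k.+1) alpha ^+ (i - 2) *: 'X^i
    :> {poly R}.
  by rewrite scaler_sumr; apply: eq_bigr => i _; rewrite scalerA; congr (_ *: _); ring.
rewrite /run_denominator sumE mulrBl -scalerAl mulr_sum_geometricX //.
rewrite -!mul_polyC !(polyCM, polyCB, polyCD, polyC1); ring.
Qed.

Lemma zero_no_run_denominator :
  fps_mul zero_no_run (fps_of_poly run_denominator) = fps_of_poly first_zero_poly.
Proof.
apply/funext => -[|n].
  rewrite /fps_mul big_ord1 mul0r /fps_of_poly coefD coefZ coefX mulr0 add0r.
  by rewrite coef_sum_scaleXn.
rewrite fps_mulC /fps_mul /fps_of_poly big_ord_recl coef_run_denominator0 mul1r.
(* The last term of the convolution vanishes since [zero_no_run 0 = 0]; the others cancel against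
   the renewal sum. *)
rewrite subn0 zero_no_run_recursion big_ord_recr /= subnn mulr0 addr0 addrAC.
rewrite -big_split big1 /= => [|j _]; last first.
  rewrite /bump /= add1n coef_run_denominatorS subSS.
  by case: ifP; rewrite ?mulNr ?subrr // mul0r oppr0 addr0.
rewrite add0r coefD coefZ coefX coef_sum_scaleXn; case: n => [|n] /=.
  by rewrite k_gt0 mulr1 addr0.
by rewrite mulr0 add0r subn2 ltnS.
Qed.

(** The first run starts either right after a zero or at trial 1, which gives the two summands. *)
Lemma waiting_time_pgf_decomposition : waiting_time_pgf X k = fun n =>
  fps_mul (fps_of_poly ((alpha ^+ (k - 1) * (1 - beta)) *: 'X^k)) zero_no_run n
  + fps_of_poly ((alpha ^+ (k - 1) * p) *: 'X^k) n.
Proof.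
apply/funext => n; rewrite fps_mul_scaleXn /fps_of_poly coefZ coefXn.
case: (ltngtP n k) => [nk|kn|->].
- by rewrite waiting_time_pgf_lt // mulr0 addr0.
- rewrite -{1}(subnK (ltnW kn)) waiting_time_pgf_gt ?subn_gt0 //.
  by rewrite mulr0 addr0.
- by rewrite subnn mulr0 add0r mulr1 waiting_time_pgf_eq.
Qed.

Lemma waiting_time_pgf_denominator :
  fps_mul (waiting_time_pgf X k) (fps_of_poly run_denominator) =
  fps_of_poly (alpha ^+ (k - 1) *: 'X^k * (p%:P + (1 - p - beta) *: 'X)).
Proof.
apply/funext => n; rewrite waiting_time_pgf_decomposition fps_mulDl.
rewrite -fps_mulA zero_no_run_denominator -!fps_of_polyM /fps_of_poly -coefD.
congr ((_ : {poly R})`_n); rewrite /first_zero_poly /run_denominator.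
(* The contributions of [S] to [(1 - beta) * first_zero_poly + p * run_denominator] cancel, leaving
   only constant and linear terms. *)
set S : {poly R} := \sum_(2 <= i < k.+1) alpha ^+ (i - 2) *: 'X^i.
have sumS c : \sum_(2 <= i < k.+1) (alpha ^+ (i - 2) * c) *: 'X^i = c *: S.
  by rewrite /S scaler_sumr; apply: eq_bigr => i _; rewrite scalerA mulrC.
under eq_bigr do rewrite -mulrA.
under [in X in _ + X]eq_bigr do rewrite -mulrA.
rewrite !sumS -!mul_polyC !(polyCM, polyCB, polyCD, polyC1); ring.
Qed.

End Chain.
End RunsOfOnes.

Theorem theorem2p17 (d : measure_display) (Omega : measurableType d)
  (R : realType) (P : probability Omega R) (X : nat -> {RV P >-> bool})
  (p q alpha beta : R) (k : nat)
  (hq : q = 1 - p)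
  (hX : markov_bernoulli X p alpha beta)
  (hk : (1 <= k)%N) :
  waiting_time_pgf X k =
    fps_div
      (fps_of_poly (alpha ^+ (k - 1) *: 'X^k * (p%:P + (q - beta) *: 'X)))
      (fps_of_poly (1 - beta *: 'X
        - \sum_(2 <= i < k.+1)
            (alpha ^+ (i - 2) * (1 - alpha) * (1 - beta)) *: 'X^i))
  /\
  waiting_time_pgf X k =
    fps_div
      (fps_of_poly (alpha ^+ (k - 1) *: 'X^k * (p%:P + (q - beta) *: 'X)
        * (1 - alpha *: 'X)))
      (fps_of_poly (1 - (alpha + beta) *: 'X - (1 - alpha - beta) *: 'X^2
        + (alpha ^+ (k - 1) * (1 - alpha) * (1 - beta)) *: 'X^(k.+1))).
Proof.
have D0 := coef_run_denominator0 alpha beta k.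
have GD := waiting_time_pgf_denominator hX hk.
rewrite hq; split; first by apply: fps_div_unique GD; rewrite /fps_of_poly D0 oner_neq0.
(* Expanding by [1 - alpha *: 'X] keeps the constant coefficient of the denominator equal to 1, so
   the quotient is still unique. *)
rewrite -run_denominator_mulX //; apply: fps_div_unique; last first.
  by rewrite fps_of_polyM fps_mulA GD -fps_of_polyM.
rewrite /fps_of_poly coef0M D0 coefB coef1 coefZ coefX mulr0 subr0 mulr1.
exact: oner_neq0.
Qed.
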